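(* Let $\lambda>1$ be an integer, $N_T=2^\lambda$ and $n=2^{\lambda-1}$. Let $S_\lambda(x_1,\dots,x_{2n})$ be the $N_T\times N_T$ linear design in $2n=2^\lambda$ complex variables obtained by the iterated ABBA construction followed by the doubling construction (defined in the context). Let $M$ be such that $m=\sqrt[4]{M}$ is an even positive integer, and let $0<r_1<r_2<\dots<r_{m/2}$ be real numbers with $\sum_{q=1}^{m/2} r_q^2=\frac{m}{2}$. Let $\mathscr{A}_0=\{p_1,\dots,p_m\}\subset\mathbb{R}^{n}$ be defined, for $q=1,\dots,\frac{m}{2}$, by $$p_{2q-1}=r_q\,e_{((q-1)\bmod n)+1},\qquad p_{2q}=-r_q\,e_{((q-1)\bmod n)+1},$$ where $e_1,\dots,e_n$ is the standard basis of $\mathbb{R}^n$. Let $\mathscr{A}=\mathscr{A}_0\times\mathscr{A}_0\times\mathscr{A}_0\times\mathscr{A}_0\subset\mathbb{R}^{4n}=\mathbb{R}^{2^{\lambda+1}}$, where the four factors are the sets of values taken respectively by the four real vectors $$(\mathrm{Re}\,x_1,\dots,\mathrm{Re}\,x_n),\quad(\mathrm{Im}\,x_1,\dots,\mathrm{Im}\,x_n),\quad(\mathrm{Re}\,x_{n+1},\dots,\mathrm{Re}\,x_{2n}),\quad(\mathrm{Im}\,x_{n+1},\dots,\mathrm{Im}\,x_{2n}).$$ Then the $M$-point signal set $\mathscr{A}$ is fully diverse for the design $S_\lambda$: for any two distinct points $X\neq X'$ of $\mathscr{A}$, the matrix $S_\lambda(X)-S_\lambda(X')$ has full rank $N_T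$.
   Context: A linear design is a square matrix whose entries are complex linear combinations of the real and imaginary parts of complex variables $x_1,\dots,x_K$. For a point $X\in\mathbb{R}^{2K}$ specifying the real and imaginary parts of all variables, $S(X)$ denotes the resulting complex matrix (codeword). ABBA construction: given a $k\times k$ linear design $A(x_1,\dots,x_K)$, form the $2k\times 2k$ linear design $$\begin{bmatrix}A(x_1,\dots,x_K) & A(x_{K+1},\dots,x_{2K})\\ A(x_{K+1},\dots,x_{2K}) & A(x_1,\dots,x_K)\end{bmatrix}.$$ Doubling construction: given a $k\times k$ linear design $A(x_1,\dots,x_K)$, form the $2k\times 2k$ linear design $$\begin{bmatrix}A(x_1,\dots,x_K) & -A(x_{K+1},\dots,x_{2K})^H\\ A(x_{K+1},\dots,x_{2K}) & A(x_1,\dots,x_K)^H\end{bmatrix},$$ where $^H$ denotes conjugate transpose. The design $S_\lambda$ for $\lambda>1$: start with $C_1(x_1,x_2)=\begin{bmatrix} x_1 & x_2 \\ x_2 & x_1 \end{bmatrix}$; apply the ABBA construction iteratively ($\lambda-2$ times) until a $2^{\lambda-1}\times 2^{\lambda-1}$ design $C(x_1,\dots,x_{2^{\lambda-1}})$ is obtained; then apply the doubling construction once to $C$ to obtain $S_\lambda(x_1,\dots,x_{2^\lambda})$. A signal set $\mathscr{A}$ is fully diverse for a design $S$ if the difference of any two codewords $S(X),S(X')$ with $X\ne X'$ in $\mathscr{A}$ has full rank. *)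

(* Defs.v *)
From mathcomp Require Import all_boot all_order all_algebra.
From mathcomp Require Import complex.
From mathcomp Require Import classical_sets.

Set Implicit Arguments.
Unset Strict Implicit.
Unset Printing Implicit Defensive.

Import Order.TTheory GRing.Theory Num.Theory.
Local Open Scope ring_scope.
Local Open Scope complex_scope.
Local Open Scope classical_set_scope.

Definition is_linear_design (R : rcfType) (k K : nat)
    (S : 'rV[R[i]]_K -> 'M[R[i]]_k) : Prop :=
  exists P Q : 'I_K -> 'M[R[i]]_k, forall x,
    S x = \sum_(j < K) ((complex.Re (x 0 j))%:C *: P j +
                        (complex.Im (x 0 j))%:C *: Q j).

(* A k x k design in the complex variables x_1, ..., x_K, as a function of the
   vector of its variables. *)
Record linear_design (R : rcfType) (k K : nat) := LinearDesign {
  design_mx :> 'rV[R[i]]_K -> 'M[R[i]]_k;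
  design_mxP : is_linear_design design_mx
}.

Definition cast_design (R : rcfType) (k k' K K' : nat)
    (ek : k = k') (eK : K = K') (S : linear_design R k K) :
    linear_design R k' K' :=
  ecast k0 (linear_design R k0 K') ek (ecast K0 (linear_design R k K0) eK S).

(* R^(2K) is ordered as (Re x_1, ..., Re x_K, Im x_1, ..., Im x_K). *)
Definition variables (R : rcfType) (K : nat) (X : 'rV[R]_(K + K)) :
    'rV[R[i]]_K :=
  \row_j (lsubmx X 0 j +i* rsubmx X 0 j).

Definition codeword (R : rcfType) (k K : nat) (S : linear_design R k K)
    (X : 'rV[R]_(K + K)) : 'M[R[i]]_k :=
  S (variables X).

Definition fully_diverse (R : rcfType) (k K : nat) (S : linear_design R k K)
    (A : set 'rV[R]_(K + K)) : Prop :=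
  forall X X', A X -> A X' -> X <> X' ->
    \rank (codeword S X - codeword S X') = k.

Definition conj_transpose (R : rcfType) (m n : nat) (A : 'M[R[i]]_(m, n)) :
    'M[R[i]]_(n, m) :=
  map_mx conjc A^T.

Definition ABBA_mx (R : rcfType) (k K : nat) (A : 'rV[R[i]]_K -> 'M[R[i]]_k)
    (x : 'rV[R[i]]_(K + K)) : 'M[R[i]]_(k + k) :=
  block_mx (A (lsubmx x)) (A (rsubmx x))
           (A (rsubmx x)) (A (lsubmx x)).

Definition doubling_mx (R : rcfType) (k K : nat)
    (A : 'rV[R[i]]_K -> 'M[R[i]]_k) (x : 'rV[R[i]]_(K + K)) :
    'M[R[i]]_(k + k) :=
  block_mx (A (lsubmx x)) (- conj_transpose (A (rsubmx x)))
           (A (rsubmx x)) (conj_transpose (A (lsubmx x))).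

Definition C1_mx (R : rcfType) (x : 'rV[R[i]]_2) : 'M[R[i]]_2 :=
  \matrix_(i, j) (if i == j then x 0 0 else x 0 1).

Lemma is_linear_designP (R : rcfType) (k K : nat)
    (S : 'rV[R[i]]_K -> 'M[R[i]]_k) :
  is_linear_design S <->
  (forall x y, S (x + y) = S x + S y) /\
  (forall (a : R) x, S (a%:C *: x) = a%:C *: S x).
Proof.
split=> [[P [Q SE]]|[SD SZ]].
  split=> [x y|a x]; rewrite !SE.
    rewrite -big_split /=; apply: eq_bigr => j _; rewrite !mxE.
    case: (x 0 j) (y 0 j) => [x1 x2] [y1 y2] /=.
    by rewrite addrACA -!scalerDl -!rmorphD.
  rewrite scaler_sumr; apply: eq_bigr => j _; rewrite !mxE.
  case: (x 0 j) => [x1 x2] /=.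
  by rewrite !mul0r subr0 addr0 scalerDr !scalerA -!rmorphM.
exists (fun j => S (delta_mx 0 j)), (fun j => S ('i *: delta_mx 0 j)) => x.
have S0 : S 0 = 0 by apply: (addrI (S 0)); rewrite -SD !addr0.
rewrite {1}[x]row_sum_delta (big_morph S SD S0); apply: eq_bigr => j _.
rewrite -!SZ -SD; congr S; rewrite scalerA -scalerDl mulrC.
by rewrite -complexE.
Qed.

Lemma ABBA_subproof (R : rcfType) (k K : nat) (A : linear_design R k K) :
  is_linear_design (ABBA_mx A).
Proof.
have /is_linear_designP[AD AZ] := design_mxP A.
apply/is_linear_designP; split=> [x y|a x]; rewrite /ABBA_mx.
  by rewrite !linearD /= !AD add_block_mx.
by rewrite !linearZ /= !AZ scale_block_mx.
Qed.

Lemma doubling_subproof (R : rcfType) (k K : nat) (A : linear_design R k K) :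
  is_linear_design (doubling_mx A).
Proof.
have /is_linear_designP[AD AZ] := design_mxP A.
apply/is_linear_designP; split=> [x y|a x]; rewrite /doubling_mx /conj_transpose.
  by rewrite !linearD /= !AD !linearD /= !map_mxD opprD add_block_mx.
rewrite !linearZ /= !AZ !linearZ /= !map_mxZ /= oppr0 -scalerN.
by rewrite scale_block_mx.
Qed.

Lemma C1_subproof (R : rcfType) : is_linear_design (@C1_mx R).
Proof.
apply/is_linear_designP; split=> [x y|a x]; apply/matrixP => i j; rewrite !mxE;
  by case: eqP.
Qed.

Definition ABBA (R : rcfType) (k K : nat) (A : linear_design R k K) :
    linear_design R (k + k) (K + K) :=
  LinearDesign (ABBA_subproof A).

Definition doubling (R : rcfType) (k K : nat) (A : linear_design R k K) :
    linear_design R (k + k) (K + K) :=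
  LinearDesign (doubling_subproof A).

Definition C1 (R : rcfType) : linear_design R 2 2 :=
  LinearDesign (C1_subproof R).

Fixpoint iter_ABBA (R : rcfType) (k K : nat) (A : linear_design R k K)
    (j : nat) :
    linear_design R (iter j (fun d => d + d)%N k) (iter j (fun d => d + d)%N K) :=
  match j with
  | 0 => A
  | j'.+1 => ABBA (iter_ABBA A j')
  end.

Lemma iter_double_subproof (l : nat) (hl : (1 < l)%N) :
  iter (l - 2) (fun d => d + d)%N 2 = (2 ^ l.-1)%N.
Proof.
case: l hl => [|[|l]] // _; rewrite subSS subSS subn0 /=.
by elim: l => //= l ->; rewrite addnn -mul2n -expnS.
Qed.

Lemma expn2_subproof (l : nat) (hl : (1 < l)%N) :
  (2 ^ l.-1 + 2 ^ l.-1 = 2 ^ l)%N.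
Proof. by rewrite addnn -mul2n -expnS prednK // ltnW. Qed.

Definition C_design (R : rcfType) (l : nat) (hl : (1 < l)%N) :
    linear_design R (2 ^ l.-1) (2 ^ l.-1) :=
  cast_design (iter_double_subproof hl) (iter_double_subproof hl)
    (iter_ABBA (C1 R) (l - 2)).

(* The 2 ^ l variables are kept split as n + n with n = 2 ^ (l - 1). *)
Definition S_design (R : rcfType) (l : nat) (hl : (1 < l)%N) :
    linear_design R (2 ^ l) (2 ^ l.-1 + 2 ^ l.-1) :=
  cast_design (expn2_subproof hl) erefl (doubling (C_design R hl)).

(* e_(q + 1) for q < n, where e_1, ..., e_n is the standard basis of R^n *)
Definition basis_vector (R : rcfType) (n q : nat) : 'rV[R]_n :=
  \row_j (j == q :> nat)%:R.

(* The radii r_1, ..., r_(m/2) are indexed from 0, so that r_(q+1) is r q. *)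
Definition component_set (R : rcfType) (n h : nat) (r : 'I_h -> R) :
    set 'rV[R]_n :=
  [set p | exists q : 'I_h,
    p = r q *: basis_vector R n (q %% n) \/
    p = - r q *: basis_vector R n (q %% n)].

Definition signal_set (R : rcfType) (n h : nat) (r : 'I_h -> R) :
    set 'rV[R]_((n + n) + (n + n)) :=
  [set X | let re := lsubmx X in let im := rsubmx X in
    [/\ component_set r (lsubmx re), component_set r (lsubmx im),
        component_set r (rsubmx re) & component_set r (rsubmx im)]].

(* Main.v *)
(** All the blocks A(x), A(y), A(x)^H, A(y)^H of the doubled design are
    diagonalised simultaneously by a Hadamard matrix, and their eigenvalues are
    sums of the variables with signs.  The doubled matrix is therefore
    invertible as soon as, for every choice of signs, the signed sums of x and
    of y do not both vanish.  A signed sum takes the value ± r_q on a point of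
    A_0, where it is thus injective, because the r_q are positive and distinct;
    so the signed sums of a difference of codewords vanish together only if the
    codewords come from the same point. *)
Require Import Defs.
From mathcomp Require Import all_boot all_order all_algebra.
From mathcomp Require Import complex ring.
From mathcomp Require Import classical_sets cardinality reals.

Set Implicit Arguments.
Unset Strict Implicit.
Unset Printing Implicit Defensive.

Import Order.TTheory GRing.Theory Num.Theory.
Local Open Scope ring_scope.
Local Open Scope classical_set_scope.
Local Open Scope card_scope.

Definition signed_sum (F : pzRingType) (K : nat) (e : 'I_K -> bool)
    (x : 'rV[F]_K) : F :=
  \sum_j (-1) ^+ e j * x 0 j.

Lemma signed_sumB (F : pzRingType) (K : nat) (e : 'I_K -> bool)
    (x y : 'rV[F]_K) :
  signed_sum e (x - y) = signed_sum e x - signed_sum e y.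
Proof. by rewrite -sumrB; apply: eq_bigr => j _; rewrite !mxE mulrBr. Qed.

(** The Sylvester recursion for Hadamard rows: a row [e] of signs gives the rows (e, e) and (e, -e)
    of twice the length, according to [b]. *)
Lemma signed_sum_split (F : pzRingType) (K : nat) (e : 'I_K -> bool)
    (b : bool) (x : 'rV[F]_(K + K)) :
  signed_sum (fun j : 'I_(K + K) => match fintype.split j with
    | inl i => e i
    | inr i => b (+) e i
    end) x =
  signed_sum e (lsubmx x + (-1) ^+ b *: rsubmx x).
Proof.
rewrite /signed_sum big_split_ord /= -big_split; apply: eq_bigr => j _.
rewrite -[lshift K j]/(unsplit (inl j : 'I_K + 'I_K)).
rewrite -[rshift K j]/(unsplit (inr j : 'I_K + 'I_K)).
rewrite !unsplitK !mxE mulrDr addbC signr_addb mulrA; congr (_ + _ * _).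
Qed.

(** The brackets on the right are the two blocks of the row (u1, u2) times the ABBA matrix of [P]
    and [Q]. This is the product in the group ring of Z/2, with the generator evaluated at a
    sign. *)
Lemma mulmx_signed (F : comPzRingType) (m k n : nat) (b : bool)
    (u1 u2 : 'M[F]_(m, k)) (P Q : 'M[F]_(k, n)) :
  (u1 + (-1) ^+ b *: u2) *m (P + (-1) ^+ b *: Q) =
  (u1 *m P + u2 *m Q) + (-1) ^+ b *: (u1 *m Q + u2 *m P).
Proof.
rewrite mulmxDl !mulmxDr -!scalemxAl -!scalemxAr scalerA -signr_addb addbb.
by rewrite scale1r [_ *: _ + u2 *m Q]addrC addrACA scalerDr.
Qed.

(* The row kernel of the doubled matrix is trivial.  Only the signs given by the
   characters of (Z/2)^(l-1) are eigenvalues of the design; asking for all signs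
   is what makes the condition pass through ABBA without naming characters. *)
Definition doubling_regular (R : rcfType) (k K : nat)
    (A : 'rV[R[i]]_K -> 'M[R[i]]_k) : Prop :=
  forall x y : 'rV[R[i]]_K,
    (forall e, signed_sum e x = 0 -> signed_sum e y = 0 -> False) ->
  forall u v : 'rV[R[i]]_k,
    u *m A x + v *m A y = 0 ->
    v *m conj_transpose (A x) - u *m conj_transpose (A y) = 0 ->
  u = 0 /\ v = 0.

Lemma doubling_regular_cast (R : rcfType) (k k' K K' : nat) (ek : k = k')
    (eK : K = K') (S : linear_design R k K) :
  doubling_regular S -> doubling_regular (cast_design ek eK S).
Proof. by case: k' / ek; case: K' / eK. Qed.

Lemma sqr_norm_add_neq0 (R : rcfType) (x y : R[i]) :
  (x = 0 -> y = 0 -> False) -> x * conjc x + y * conjc y != 0.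
Proof.
move=> xy0; rewrite -[conjc x]/(Num.conj x) -[conjc y]/(Num.conj y) -!normCK.
apply/eqP => /eqP; rewrite paddr_eq0 ?exprn_ge0 //.
by rewrite !expf_eq0 /= !normr_eq0 => /andP[/eqP/xy0 + /eqP].
Qed.

(** Doubling the 1 x 1 design gives the Alamouti matrix, whose determinant |x|^2 + |y|^2 vanishes
    only if x = y = 0. *)
Lemma doubling_regular_id (R : rcfType) :
  doubling_regular (id : 'rV[R[i]]_1 -> 'M[R[i]]_1).
Proof.
move=> x y xy0 u v /matrixP/(_ 0 0) + /matrixP/(_ 0 0).
have /sqr_norm_add_neq0 : x 0 0 = 0 -> y 0 0 = 0 -> False.
  by move: (xy0 xpred0); rewrite /signed_sum !big_ord1 !mul1r.
rewrite !mxE !big_ord1 !mxE [u]mx11_scalar [v]mx11_scalar !mxE !eqxx !mulr1n.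
move: (x 0 0) (y 0 0) (u 0 0) (v 0 0) => {x y xy0 u v}.
move=> x y u v n0 e1 e2.
(* Multiplying by the adjugate of the 2 x 2 matrix isolates [u], and then [v]. *)
have u0 : u * (x * conjc x + y * conjc y) = 0.
  transitivity ((u * x + v * y) * conjc x - (v * conjc x - u * conjc y) * y).
    by ring.
  by rewrite e1 e2 !mul0r subr0.
have v0 : v * (x * conjc x + y * conjc y) = 0.
  transitivity ((u * x + v * y) * conjc y + (v * conjc x - u * conjc y) * x).
    by ring.
  by rewrite e1 e2 !mul0r addr0.
move: u0 v0 => /eqP + /eqP; rewrite !mulf_eq0 (negPf n0) !orbF.
by move=> /eqP -> /eqP ->; rewrite raddf0.
Qed.

(** The combinations u1 ± u2 and v1 ± v2 decouple the equations into two systems for [A], at the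
    arguments x1 ± x2 and y1 ± y2. Signed sums of these arguments are signed sums of [x] and [y], so
    the hypothesis carries over. *)
Lemma doubling_regular_ABBA (R : rcfType) (k K : nat)
    (A : linear_design R k K) :
  doubling_regular A -> doubling_regular (ABBA_mx A).
Proof.
have /is_linear_designP[AD AZ] := design_mxP A.
(* [A] is only real-linear; this suffices because the coefficient is a sign, which conjugation also
   fixes. *)
have AS (b : bool) x x' : A (x + (-1) ^+ b *: x') = A x + (-1) ^+ b *: A x'.
  by rewrite AD; have := AZ ((-1) ^+ b) x'; rewrite rmorph_sign => ->.
have ctS (b : bool) (B D : 'M[R[i]]_k) :
    conj_transpose (B + (-1) ^+ b *: D) =
    conj_transpose B + (-1) ^+ b *: conj_transpose D.
  by rewrite /conj_transpose linearD linearZ map_mxD map_mxZ rmorph_sign.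
move=> Areg x y xy0 u v.
rewrite -[u]hsubmxK -[v]hsubmxK; move: (lsubmx u) (rsubmx u) => u1 u2.
move: (lsubmx v) (rsubmx v) => v1 v2.
rewrite /conj_transpose /ABBA_mx !tr_block_mx !map_block_mx !mul_row_block.
rewrite opp_row_mx !add_row_mx -!row_mx0 => /eq_row_mx[e1 e2] /eq_row_mx[e3 e4].
have reg (b : bool) : u1 + (-1) ^+ b *: u2 = 0 /\ v1 + (-1) ^+ b *: v2 = 0.
  apply: (Areg (lsubmx x + (-1) ^+ b *: rsubmx x)
               (lsubmx y + (-1) ^+ b *: rsubmx y)).
  - move=> e; rewrite -(signed_sum_split e b x) -(signed_sum_split e b y).
    exact: xy0.
  - by rewrite !AS !mulmx_signed addrACA -scalerDr e1 e2 scaler0 addr0.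
  rewrite !AS !ctS !mulmx_signed opprD addrACA -scalerBr.
  by rewrite e3 e4 scaler0 addr0.
have half0 (w1 w2 : 'rV[R[i]]_k) :
    (forall b : bool, w1 + (-1) ^+ b *: w2 = 0) -> row_mx w1 w2 = row_mx 0 0.
  move=> w0; have := w0 false; have := w0 true; rewrite !(scaleN1r, scale1r).
  move=> /eqP; rewrite subr_eq0 => /eqP ->; rewrite -mulr2n -scaler_nat.
  by move=> /eqP; rewrite scaler_eq0 pnatr_eq0 => /eqP ->.
by split; apply: half0 => b; have [] := reg b.
Qed.

(** Allows the induction to start from the 1 x 1 identity design. *)
Lemma C1_mxE (R : rcfType) (x : 'rV[R[i]]_2) :
  C1_mx x = ABBA_mx (id : 'rV[R[i]]_1 -> 'M_1) x.
Proof.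
rewrite /ABBA_mx; apply/matrixP => i j; rewrite mxE.
have [a ->|a ->] := @split_ordP 1 1 i; have [b ->|b ->] := @split_ordP 1 1 j;
  rewrite !ord1 (@block_mxEul _ 1 1 1 1, @block_mxEur _ 1 1 1 1,
    @block_mxEdl _ 1 1 1 1, @block_mxEdr _ 1 1 1 1) !mxE /=;
  congr (x _ _); exact: val_inj.
Qed.

Lemma doubling_regular_iter_ABBA (R : rcfType) (k K j : nat)
    (A : linear_design R k K) :
  doubling_regular A -> doubling_regular (iter_ABBA A j).
Proof. by move=> Areg; elim: j => //= j; apply: doubling_regular_ABBA. Qed.

Lemma doubling_regular_C (R : rcfType) (l : nat) (hl : (1 < l)%N) :
  doubling_regular (C_design R hl).
Proof.
apply/doubling_regular_cast/doubling_regular_iter_ABBA.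
have id_linear : is_linear_design (id : 'rV[R[i]]_1 -> 'M[R[i]]_1).
  exact/is_linear_designP.
have := doubling_regular_ABBA (A := LinearDesign id_linear)
  (@doubling_regular_id R).
by move=> reg x y xy0 u v; rewrite /= !C1_mxE; apply: reg.
Qed.

(** The two column blocks of [w *m doubling_mx A x] are the two equations of [doubling_regular], so
    the row kernel is trivial. *)
Lemma rank_doubling_mx (R : rcfType) (k K : nat)
    (A : 'rV[R[i]]_K -> 'M[R[i]]_k) (x : 'rV[R[i]]_(K + K)) :
  doubling_regular A ->
  (forall e, signed_sum e (lsubmx x) = 0 -> signed_sum e (rsubmx x) = 0 ->
    False) ->
  \rank (doubling_mx A x) = (k + k)%N.
Proof.
move=> Areg x0; apply/eqP/inj_row_free => w.
rewrite -[w]hsubmxK mul_row_block mulmxN [- _ + _]addrC -row_mx0.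
move=> /eq_row_mx[e1 e2].
by have [-> ->] := Areg _ _ x0 _ _ e1 e2.
Qed.

Lemma variablesB (R : rcfType) (K : nat) (X Y : 'rV[R]_(K + K)) :
  variables (X - Y) = variables X - variables Y.
Proof. by apply/matrixP => i j; rewrite !mxE. Qed.

Lemma codewordB (R : rcfType) (k K : nat) (S : linear_design R k K)
    (X Y : 'rV[R]_(K + K)) :
  codeword S (X - Y) = codeword S X - codeword S Y.
Proof.
have /is_linear_designP[SD SZ] := design_mxP S.
rewrite /codeword variablesB SD; congr (_ + _).
by have := SZ (-1) (variables Y); rewrite rmorphN1 !scaleN1r.
Qed.

Lemma fully_diverse_cast (R : rcfType) (k k' K : nat) (ek : k = k')
    (S : linear_design R k K) (A : set 'rV[R]_(K + K)) :
  fully_diverse S A -> fully_diverse (cast_design ek erefl S) A.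
Proof. by case: k' / ek. Qed.

(** Since the signs are real, the four factors of the signal set can be treated separately. *)
Lemma signed_sum_complex (R : rcfType) (K : nat) (e : 'I_K -> bool)
    (x : 'rV[R[i]]_K) :
  signed_sum e x = (signed_sum e (map_mx (@complex.Re R) x)
                    +i* signed_sum e (map_mx (@complex.Im R) x))%C.
Proof.
apply/eqP; rewrite eq_complex /= !raddf_sum.
apply/andP; split; apply/eqP/eq_bigr => j _; rewrite !mxE;
  by case: (e j) (x 0 j) => [] [a b]; rewrite ?mulN1r ?mul1r.
Qed.

Definition component_point (R : rcfType) (n h : nat) (r : 'I_h -> R)
    (qs : 'I_h * bool) : 'rV[R]_n :=
  (-1) ^+ qs.2 * r qs.1 *: basis_vector R n (qs.1 %% n).

Lemma component_setE (R : rcfType) (n h : nat) (r : 'I_h -> R) :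
  component_set (n := n) r = range (component_point n r).
Proof.
apply/seteqP; split=> [p [q [] ->]|_ [[q s] _ <-]].
- by exists (q, false) => //; rewrite /component_point mul1r.
- by exists (q, true) => //; rewrite /component_point mulN1r.
by exists q; case: s; [right|left]; rewrite /component_point ?mulN1r ?mul1r.
Qed.

(** Only one coordinate of the point is nonzero, so the signed sum is ± r_q: its absolute value
    determines [q], and its sign then determines [s]. *)
Lemma signed_sum_component_point_inj (R : rcfType) (n h : nat) (r : 'I_h -> R)
    (e : 'I_n -> bool) :
  (0 < n)%N -> (forall q, 0 < r q) -> injective r ->
  injective (fun qs => signed_sum e (component_point n r qs)).
Proof.
move=> n0 r0 rI [q s] [q' s'] /=.
have E (t : 'I_h * bool) : signed_sum e (component_point n r t) =
    (-1) ^+ (e (Ordinal (ltn_pmod t.1 n0)) (+) t.2) * r t.1.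
  rewrite /signed_sum (bigD1 (Ordinal (ltn_pmod t.1 n0))) //= big1 => [|j jn].
    by rewrite !mxE eqxx mulr1 addr0 signr_addb mulrA.
  by rewrite !mxE -[_ == _]/(j == Ordinal (ltn_pmod t.1 n0)) (negPf jn) !mulr0.
rewrite !E /= => Eq; have /rI qq' : r q = r q'.
  by have /(congr1 Num.norm) := Eq; rewrite !normrMsign !gtr0_norm.
move: Eq; rewrite -{}qq' => /(mulIf (lt0r_neq0 (r0 q))).
by move=> /signr_inj/addbI ->.
Qed.

Theorem theorem2 (R : realType) (l : nat) (hl : (1 < l)%N)
    (M m : nat) (hM : M = (m ^ 4)%N) (hm_even : ~~ odd m) (hm_pos : (0 < m)%N)
    (r : 'I_(m./2) -> R)
    (hr_pos : forall q, 0 < r q)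
    (hr_lt : forall q q' : 'I_(m./2), (q < q')%N -> r q < r q')
    (hr_energy : \sum_(q < m./2) r q ^+ 2 = m%:R / 2) :
  (signal_set (n := 2 ^ l.-1) r #= `I_M) /\
  fully_diverse (S_design R hl) (signal_set (n := 2 ^ l.-1) r).
Proof.
have rI : injective r.
  move=> q q' rqq'; apply/val_inj; case: (ltngtP q q') => // /hr_lt;
    by rewrite rqq' ltxx.
have n0 : (0 < 2 ^ l.-1)%N by rewrite expn_gt0.
have phiI (e : 'I_(2 ^ l.-1) -> bool) :=
  signed_sum_component_point_inj (e := e) n0 hr_pos rI.
have pI : injective (component_point (2 ^ l.-1) r).
  by apply: (@inj_compr _ _ _ (signed_sum (fun=> false))); apply: phiI.
split.
  pose T := ('I_(m./2) * bool)%type.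
  (* [z.1] holds the real and imaginary parts of the first n variables and [z.2] those of the last
     n, whereas the coordinates list all real parts first. *)
  pose f (z : (T * T) * (T * T)) :=
    row_mx (row_mx (component_point (2 ^ l.-1) r z.1.1)
                   (component_point (2 ^ l.-1) r z.2.1))
           (row_mx (component_point (2 ^ l.-1) r z.1.2)
                   (component_point (2 ^ l.-1) r z.2.2)).
  have fI : injective f.
    move=> [[a b] [c d]] [[a' b'] [c' d']] /eq_row_mx[].
    by move=> /eq_row_mx[/pI/= -> /pI/= ->] /eq_row_mx[/pI/= -> /pI/= ->].
  have -> : signal_set (n := 2 ^ l.-1) r = range f.
    rewrite /signal_set component_setE.
    apply/seteqP; split=> [X|_ [z _ <-]].
      move=> /= [[a _ Xa] [b _ Xb] [c _ Xc] [d _ Xd]].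
      exists ((a, b), (c, d)) => //.
      by rewrite /f /= Xa Xb Xc Xd !hsubmxK.
    rewrite /= /f !(row_mxKl, row_mxKr).
    by split; [exists z.1.1|exists z.1.2|exists z.2.1|exists z.2.2].
  rewrite (card_eql (inj_card_eq (in2W fI))).
  (* Evenness of [m] gives |T| = 2 (m/2) = m. *)
  have -> : M = #|{: (T * T) * (T * T)}|.
    rewrite !card_prod card_bool card_ord muln2 halfK (negPf hm_even) subn0 hM.
    by rewrite !expnS expn0 muln1 mulnA.
  apply: card_eq_trans (card_esym card_II).
  have <- : range (@enum_val _ (mem {: (T * T) * (T * T)})) = setT.
    apply/seteqP; split=> // z _.
    by exists (enum_rank z) => //; apply: enum_rankK.
  exact: inj_card_eq (in2W enum_val_inj).
apply: fully_diverse_cast => X X' [X1 X2 X3 X4] [X1' X2' X3' X4'] XX'.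
rewrite -codewordB; apply: rank_doubling_mx; first exact: doubling_regular_C.
move=> e; rewrite !signed_sum_complex.
(* Any single sign vector [e] already separates the points of each factor. *)
have eq0 p p' : component_set r p -> component_set r p' ->
    signed_sum e (p - p') = 0 -> p = p'.
  rewrite component_setE signed_sumB => -[a _ <-] [b _ <-] /subr0_eq.
  by move=> /phiI ->.
have -> : map_mx (@complex.Re R) (lsubmx (variables (X - X'))) =
    lsubmx (lsubmx X) - lsubmx (lsubmx X') by apply/rowP => j; rewrite !mxE.
have -> : map_mx (@complex.Im R) (lsubmx (variables (X - X'))) =
    lsubmx (rsubmx X) - lsubmx (rsubmx X') by apply/rowP => j; rewrite !mxE.
have -> : map_mx (@complex.Re R) (rsubmx (variables (X - X'))) =
    rsubmx (lsubmx X) - rsubmx (lsubmx X') by apply/rowP => j; rewrite !mxE.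
have -> : map_mx (@complex.Im R) (rsubmx (variables (X - X'))) =
    rsubmx (rsubmx X) - rsubmx (rsubmx X') by apply/rowP => j; rewrite !mxE.
move=> [/(eq0 _ _ X1 X1') E1 /(eq0 _ _ X2 X2') E2].
move=> [/(eq0 _ _ X3 X3') E3 /(eq0 _ _ X4 X4') E4]; apply: XX'.
rewrite -[X]hsubmxK -[X']hsubmxK -[lsubmx X]hsubmxK -[rsubmx X]hsubmxK.
by rewrite E1 E2 E3 E4 !hsubmxK.
Qed.
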